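(* Let $\Lambda$ be a finite or countable alphabet and $\mu$ an ergodic shift-invariant probability measure on $\Lambda^{\mathbb N}$. If $S\subset\mathbb N$ is superficial and has positive lower density, then $S$ preserves $\mu$-normality: for every $\mu$-normal $x\in\Lambda^{\mathbb N}$, $x|_S$ is $\mu$-normal.
   Context: $x$ is $\mu$-normal if $\frac1n\sum_{i<n}\delta_{\sigma^ix}\to\mu$ weak-*, $\sigma$ the left shift. For $S=\{s_1<s_2<\dots\}$, $x|_S=(x_{s_1},x_{s_2},\dots)$. With $y=\mathbbm1_S$ and $\mathcal M_y$ the set of weak-* accumulation points of $\frac1n\sum_{i<n}\delta_{\sigma^iy}$, $S$ is superficial if $\mathcal M_y\subset\mathrm{conv}\{\delta_{\bar0},\delta_{\bar1}\}$ (point masses at the constant sequences $0^\infty$ and $1^\infty$). Lower density $\underline d(S)=\liminf_n\#(S\cap\{1,\dots,n\})/n$. *)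

(* Defs.v *)
From HB Require Import structures.
From mathcomp Require Import all_boot all_order all_algebra.
From mathcomp Require Import all_classical all_reals all_analysis.
Set Implicit Arguments. Unset Strict Implicit. Unset Printing Implicit Defensive.
Import Order.TTheory GRing.Theory Num.Theory.
Import numFieldNormedType.Exports.
Local Open Scope classical_set_scope.
Local Open Scope ring_scope.

(* Positions are 0-indexed: x 0 is the first letter x_1 of the paper. *)

Definition seqtop (L : pointedType) : Type :=
  prod_topology (fun _ : nat => discrete_topology L).

Definition Omega (L : pointedType) : Type :=
  g_sigma_algebraType (@open (seqtop L)).

Definition shift {L : Type} (x : nat -> L) : nat -> L := fun n => x n.+1.

Definition Cb {R : realType} {L : pointedType} (f : Omega L -> R) : Prop :=
  continuous (f : seqtop L -> R) /\ exists M : R, forall y, `|f y| <= M.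

(* integral of f against the empirical measure (1/n) sum_{i<n} delta_{sigma^i x} *)
Definition avg {R : realType} {L : Type} (x : nat -> L) (n : nat)
  (f : (nat -> L) -> R) : R :=
  (n%:R)^-1 * \sum_(i < n) f (iter i shift x).

Definition normal {R : realType} {L : pointedType} (mu : probability (Omega L) R)
  (x : Omega L) : Prop :=
  forall f : Omega L -> R, Cb f ->
    (fun n => (avg x n f)%:E) @ \oo --> (\int[mu]_y (f y)%:E)%E.

Definition accum_point {R : realType} {L : pointedType} (x : Omega L)
  (nu : probability (Omega L) R) : Prop :=
  exists ns : nat -> nat, (forall k, (ns k < ns k.+1)%N) /\
    forall f : Omega L -> R, Cb f ->
      (fun k => (avg x (ns k) f)%:E) @ \oo --> (\int[nu]_y (f y)%:E)%E.

Definition shift_invariant {R : realType} {L : pointedType}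
  (mu : probability (Omega L) R) : Prop :=
  forall A : set (Omega L), measurable A -> mu (shift @^-1` A) = mu A.

Definition ergodic {R : realType} {L : pointedType}
  (mu : probability (Omega L) R) : Prop :=
  forall A : set (Omega L), measurable A -> shift @^-1` A = A ->
    mu A = 0%E \/ mu A = 1%E.

Definition indic (S : set nat) : Omega bool := fun n => `[< S n >].

Definition superficial (R : realType) (S : set nat) : Prop :=
  forall nu : probability (Omega bool) R, accum_point (indic S) nu ->
    exists t : R, 0 <= t <= 1 /\
      forall A : set (Omega bool), measurable A ->
        nu A = (t%:E * @dirac _ (Omega bool) ((fun _ : nat => false) : Omega bool) R A
                + (1 - t)%:E * @dirac _ (Omega bool) ((fun _ : nat => true) : Omega bool) R A)%E.

Definition lower_density (R : realType) (S : set nat) : R :=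
  limn_inf (fun n : nat => (n%:R)^-1 * \sum_(i < n) (\1_S i : R)).

(* Main.v *)
Require Import Defs.
From HB Require Import structures.
From mathcomp Require Import all_boot all_order all_algebra.
From mathcomp Require Import all_classical all_reals all_analysis.
From mathcomp Require Import measurable_realfun.
From mathcomp Require Import ring lra zify.
Set Implicit Arguments. Unset Strict Implicit. Unset Printing Implicit Defensive.
Import Order.TTheory GRing.Theory Num.Theory.
Import numFieldNormedType.Exports.
Local Open Scope classical_set_scope.
Local Open Scope ring_scope.

(* Let y be the indicator of S. A limit point of the empirical measures of y gives
   no mass to {y_0 <> y_1}, so the sites where y changes have density zero: S
   consists of long blocks and long gaps. Hence, for g depending on finitely many
   coordinates with mean zero, the sum of g along x|_S is close to the sum of
   y_i g(sigma^i x), and there g can be replaced by its window average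
   A_l g = (1/l) sum_{j<l} g o sigma^j. By normality of x the result is at most
   the integral of |A_l g|, which tends to 0 with l by the mean ergodic theorem.
   Positive lower density makes the normalisations by #S and by n comparable. *)

(** * Mean ergodic theorem *)

Section bounded_measurable.
Context d (T : measurableType d) (R : realType) (P : probability T R).

Definition bounded_mfun (f : T -> R) :=
  measurable_fun setT f /\ exists M : R, forall x, `|f x| <= M.

Lemma bounded_mfun_integrable f :
  bounded_mfun f -> P.-integrable setT (EFin \o f).
Proof.
move=> [mf [M fM]]; apply: measurable_bounded_integrable => //.
  exact: fin_num_fun_lty.
exists M; split; first exact: num_real.
by move=> y My x _; exact: le_trans (fM x) (ltW My).
Qed.

Lemma bounded_mfun_cst c : bounded_mfun (cst c).
Proof. by split => //; exists `|c| => x. Qed.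

Lemma bounded_mfunD f g :
  bounded_mfun f -> bounded_mfun g -> bounded_mfun (fun x => f x + g x).
Proof.
move=> [mf [M fM]] [mg [N gN]]; split; first exact: measurable_funD.
by exists (M + N) => x; rewrite (le_trans (ler_normD _ _))// lerD.
Qed.

Lemma bounded_mfunM f g :
  bounded_mfun f -> bounded_mfun g -> bounded_mfun (fun x => f x * g x).
Proof.
move=> [mf [M fM]] [mg [N gN]]; split; first exact: measurable_funM.
by exists (M * N) => x; rewrite normrM ler_pM.
Qed.

Lemma bounded_mfunZ c f : bounded_mfun f -> bounded_mfun (fun x => c * f x).
Proof. by move=> bf; exact: (bounded_mfunM (bounded_mfun_cst c) bf). Qed.

Lemma bounded_mfunN f : bounded_mfun f -> bounded_mfun (fun x => - f x).
Proof.
move=> /(bounded_mfunZ (-1)); congr bounded_mfun.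
by apply/funext => x; rewrite mulN1r.
Qed.

Lemma bounded_mfunB f g :
  bounded_mfun f -> bounded_mfun g -> bounded_mfun (fun x => f x - g x).
Proof. by move=> bf bg; exact: (bounded_mfunD bf (bounded_mfunN bg)). Qed.

Lemma bounded_mfun_sum I (r : seq I) (F : I -> T -> R) :
  (forall i, bounded_mfun (F i)) -> bounded_mfun (fun x => \sum_(i <- r) F i x).
Proof.
move=> bF; elim: r => [|i r IH].
  under eq_fun do rewrite big_nil; exact: bounded_mfun_cst.
under eq_fun do rewrite big_cons; exact: bounded_mfunD.
Qed.

Lemma bounded_mfun_norm f : bounded_mfun f -> bounded_mfun (fun x => `|f x|).
Proof.
move=> [mf [M fM]]; split; first exact: measurableT_comp.
by exists M => x; rewrite normr_id.
Qed.

Lemma bounded_mfun_indic A : measurable A -> bounded_mfun (\1_A).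
Proof.
move=> mA; split; first exact: measurable_indic.
by exists 1 => x; rewrite indicE ger0_norm// lern1 leq_b1.
Qed.

Lemma EFin_Rintegral f : bounded_mfun f ->
  ((\int[P]_x f x)%:E = \int[P]_x (f x)%:E)%E.
Proof.
by move=> /bounded_mfun_integrable fi; rewrite fineK//; exact: integrable_fin_num.
Qed.

Lemma Rintegral_probability_cst c : \int[P]_(_ in setT) c = c.
Proof.
rewrite Rintegral_cst// (_ : fine _ = 1) ?mulr1//.
rewrite -[RHS]/(fine (1%:E : \bar R)); congr fine; exact: probability_setT.
Qed.

Lemma RintegralN f : bounded_mfun f -> \int[P]_x (- f x) = - \int[P]_x f x.
Proof.
move=> bf; transitivity (\int[P]_x (-1 * f x)).
  by apply: eq_Rintegral => x _; rewrite mulN1r.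
by rewrite RintegralZl ?mulN1r//; exact: bounded_mfun_integrable.
Qed.

(** Dominated convergence with the constant [M] as dominating function, which is integrable because
    [P] is finite. *)
Lemma cvg_Rintegral_bounded (f_ : (T -> R)^nat) (f : T -> R) M :
  (forall n, measurable_fun setT (f_ n)) -> (forall n x, `|f_ n x| <= M) ->
  bounded_mfun f -> {ae P, forall x, f_ ^~ x @ \oo --> f x} ->
  (fun n => \int[P]_x f_ n x) @ \oo --> \int[P]_x f x.
Proof.
move=> mf fM bf ff.
have bf_ n : bounded_mfun (f_ n) by split => //; exists M.
have [] := @dominated_convergence _ _ _ P setT measurableT
  (fun n => EFin \o f_ n) (EFin \o f) (cst M%:E).
- by move=> n; exact/measurable_EFinP.
- by apply/measurable_EFinP; case: bf.
- apply: filterS ff => x ffx _; exact: cvg_comp ffx _.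
- exact/bounded_mfun_integrable/bounded_mfun_cst.
- by apply: aeW => x n _; rewrite lee_fin.
move=> _ _; rewrite -EFin_Rintegral// => /fine_cvgP[_].
by apply: cvg_trans; apply: near_eq_cvg; near=> n.
Unshelve. all: by end_near. Qed.

End bounded_measurable.

Section mean_ergodic.
Context d (T : measurableType d) (R : realType) (P : probability T R).
Variable s : T -> T.
Hypothesis ms : measurable_fun setT s.
Hypothesis s_inv : forall A, measurable A -> P (s @^-1` A) = P A.
Hypothesis s_erg : forall A, measurable A -> s @^-1` A = A ->
  P A = 0%E \/ P A = 1%E.
Implicit Types f h : T -> R.

Lemma bounded_mfun_comp f : bounded_mfun f -> bounded_mfun (f \o s).
Proof.
by move=> [mf [M fM]]; split; [exact: measurableT_comp|exists M => x; exact: fM].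
Qed.

Lemma Rintegral_comp_invariant f :
  bounded_mfun f -> \int[P]_x f (s x) = \int[P]_x f x.
Proof.
move=> bf; congr fine; have [mf _] := bf.
rewrite [RHS](eq_measure_integral (pushforward P s)); last first.
  by move=> A mA _; exact: esym (s_inv mA).
rewrite integral_pushforward//; first exact/measurable_EFinP.
exact/bounded_mfun_integrable/bounded_mfun_comp.
Qed.

Definition birkhoff n f x : R := \sum_(i < n) f (iter i s x).

Lemma birkhoffS n f x : birkhoff n.+1 f x = f x + birkhoff n f (s x).
Proof.
by rewrite /birkhoff big_ord_recl; congr (_ + _); apply: eq_bigr => i _; rewrite -iterSr.
Qed.

Lemma birkhoffB n f h x :
  birkhoff n (fun y => f y - h y) x = birkhoff n f x - birkhoff n h x.
Proof. by rewrite /birkhoff sumrB. Qed.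

Lemma birkhoffN n f x : birkhoff n (fun y => - f y) x = - birkhoff n f x.
Proof. by rewrite /birkhoff sumrN. Qed.

Lemma birkhoff_cst n c x : birkhoff n (cst c) x = n%:R * c.
Proof. by rewrite /birkhoff sumr_const card_ord mulr_natl. Qed.

Lemma bounded_mfun_birkhoff n f : bounded_mfun f -> bounded_mfun (birkhoff n f).
Proof.
move=> bf; apply: bounded_mfun_sum => i.
elim: (i : nat) => [//|k /bounded_mfun_comp]; congr bounded_mfun.
by apply/funext => x; rewrite iterSr.
Qed.

(* [birkhoff_max N h x] is the maximum of the sums [birkhoff n h x] for n <= N. *)
Fixpoint birkhoff_max N h x : R :=
  if N is N'.+1 then Num.max 0 (h x + birkhoff_max N' h (s x)) else 0.

Lemma bounded_mfun_birkhoff_max N h :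
  bounded_mfun h -> bounded_mfun (birkhoff_max N h).
Proof.
move=> bh; elim: N => [|N IH]; first exact: (@bounded_mfun_cst _ T R 0).
have [mg [M gM]] := bounded_mfunD bh (bounded_mfun_comp IH).
split; first exact: (@measurable_maxr _ _ R _
    (cst 0) (fun x => h x + birkhoff_max N h (s x)) (measurable_cst _) mg).
exists M => x; apply: le_trans (gM x); rewrite /=.
by rewrite maxEle; case: ifP => _ //; rewrite normr0.
Qed.

Lemma birkhoff_max_ge0 N h x : 0 <= birkhoff_max N h x.
Proof. by case: N => [|N] //=; rewrite le_max lexx. Qed.

Lemma birkhoff_max_leS N h x : birkhoff_max N h x <= birkhoff_max N.+1 h x.
Proof.
elim: N x => [|N IH] x; first exact: birkhoff_max_ge0.
by rewrite [leLHS]/= ge_max birkhoff_max_ge0 /= le_max lerD2l (IH (s x)) orbT.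
Qed.

Lemma birkhoff_le_max n N h x : (n <= N)%N -> birkhoff n h x <= birkhoff_max N h x.
Proof.
elim: N n x => [|N IH] [|n] x nN //; rewrite ?[birkhoff 0 _ _]big_ord0 ?birkhoff_max_ge0//.
by rewrite birkhoffS /= le_max lerD2l IH ?orbT.
Qed.

(** Garsia's argument: let [B] be the maximal function. Where [B] is positive,
    [h x >= B x - B (s x)]; elsewhere [B x = 0] and [B (s x) >= 0]. So the integrand dominates
    [B - B \o s], whose integral vanishes by invariance. *)
Lemma maximal_ergodic N h : bounded_mfun h ->
  0 <= \int[P]_x (h x * \1_[set y | 0 < birkhoff_max N h y] x).
Proof.
move=> bh; case: N => [|N].
  rewrite (_ : [set _ | _] = set0); last by apply/seteqP; split => x //=; rewrite ltxx.
  by apply: Rintegral_ge0 => x _; rewrite indic0 mulr0.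
set A := [set _ | _]; pose B := birkhoff_max N.+1 h.
have bB : bounded_mfun B by exact: bounded_mfun_birkhoff_max.
have mA : measurable A.
  rewrite -[A]setTI; have := bB.1 measurableT `]0, +oo[%classic.
  rewrite (_ : _ @^-1` _ = A); first by apply.
  by apply/seteqP; split => x /=; rewrite in_itv/= andbT.
have -> : 0 = \int[P]_x (B x - B (s x)).
  rewrite RintegralB//; try exact: bounded_mfun_integrable.
    by rewrite Rintegral_comp_invariant// subrr.
  exact/bounded_mfun_integrable/(bounded_mfun_comp bB).
apply: le_Rintegral => //.
- exact/bounded_mfun_integrable/(bounded_mfunB bB (bounded_mfun_comp bB)).
- exact/bounded_mfun_integrable/(bounded_mfunM bh)/bounded_mfun_indic.
move=> x _; rewrite indicE; have [Ax|Ax] := pselect (A x).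
  rewrite mem_set// mulr1 lerBlDr /B [leLHS]/=.
  move: Ax; rewrite /A /= lt_max ltxx /= => /ltW h0.
  by rewrite max_r// lerD2l birkhoff_max_leS.
rewrite memNset// mulr0 subr_le0; apply: le_trans (birkhoff_max_ge0 _ _ _).
by rewrite leNgt; apply/negP.
Qed.

(** The sets where [birkhoff_max N h] is positive increase with [N] to a set of full measure, so the
    maximal inequality passes to the limit by dominated convergence. *)
Lemma Rintegral_ge0_birkhoff h : bounded_mfun h ->
  {ae P, forall x, exists n, 0 < birkhoff n h x} -> 0 <= \int[P]_x h x.
Proof.
move=> bh ae_h; have [mh [M hM]] := bh.
pose A N := [set y | 0 < birkhoff_max N h y].
have mA N : measurable (A N).
  rewrite -[A N]setTI; have [mB _] := bounded_mfun_birkhoff_max N bh.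
  have := mB measurableT `]0, +oo[%classic.
  rewrite (_ : _ @^-1` _ = A N); first by apply.
  by apply/seteqP; split => x /=; rewrite in_itv/= andbT.
have cv : (fun N => \int[P]_x (h x * \1_(A N) x)) @ \oo --> \int[P]_x h x.
  apply: (@cvg_Rintegral_bounded _ _ _ _ _ _ M) => //.
  - by move=> n; case: (bounded_mfunM bh (bounded_mfun_indic R (mA n))).
  - move=> n x; rewrite normrM -[leRHS]mulr1 ler_pM// indicE ger0_norm//.
    by rewrite lern1 leq_b1.
  apply: filterS ae_h => x [n nx]; apply: cvg_near_cst; exists n => // k /= nk.
  rewrite indicE mem_set ?mulr1//=.
  exact: lt_le_trans nx (birkhoff_le_max _ _ nk).
rewrite -(cvg_lim _ cv)//; apply: limr_ge; first exact: cvgP cv.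
by apply: nearW => N; exact: maximal_ergodic.
Qed.

(** The set where the sums are unbounded above is invariant, so it has measure 0 or 1; measure 1
    would force the integral of [h] to be nonnegative. *)
Lemma birkhoff_ae_ubounded h : bounded_mfun h -> \int[P]_x h x < 0 ->
  {ae P, forall x, exists K : nat, forall n, birkhoff n h x <= K%:R}.
Proof.
move=> bh h_lt0; have [_ [M hM]] := bh.
pose B := [set x | forall K : nat, exists n, K%:R < birkhoff n h x].
have mB : measurable B.
  rewrite (_ : B = \bigcap_(K : nat) \bigcup_n [set x | K%:R < birkhoff n h x]).
    apply: bigcapT_measurable => K; apply: bigcupT_measurable => n.
    rewrite -[X in measurable X]setTI; have [mS _] := bounded_mfun_birkhoff n bh.
    have := mS measurableT `]K%:R, +oo[%classic.
    rewrite (_ : _ @^-1` _ = [set x | K%:R < birkhoff n h x]); first by apply.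
    by apply/seteqP; split => x /=; rewrite in_itv/= andbT.
  apply/seteqP; split => x /= xB K; first by move=> _; have [n Kn] := xB K; exists n.
  by have [n _ Kn] := xB K I; exists n.
(* Since [h] is bounded, unboundedness of the sums is strictly shift-invariant. *)
have sB : s @^-1` B = B.
  pose m := Num.bound M.
  have hm x : `|h x| < m%:R.
    apply: le_lt_trans (hM x) _; apply: archi_boundP.
    exact: le_trans (normr_ge0 _) (hM x).
  apply/seteqP; split => x /= xB K; have [n] := xB (K + m)%N; rewrite natrD => Kn.
    exists n.+1; rewrite birkhoffS.
    by have := hm x; rewrite ltr_norml => /andP[]; lra.
  case: n Kn => [|n].
    by rewrite [birkhoff 0 _ _]big_ord0 => /lt_geF; rewrite addr_ge0.
  rewrite birkhoffS => Kn; exists n.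
  by have := hm x; rewrite ltr_norml => /andP[]; lra.
have [B0|B1] := s_erg mB sB.
  exists B; split => // x /= xK; rewrite /B /= => K.
  apply: contrapT => nK; apply: xK; exists K => n; rewrite leNgt; apply/negP => Kn.
  by apply: nK; exists n.
suff : 0 <= \int[P]_x h x by rewrite leNgt h_lt0.
(* On [B], which now has full measure, taking [K = 0] yields a positive sum. *)
apply: Rintegral_ge0_birkhoff => //; exists (~` B); split.
- exact: measurableC.
- by rewrite probability_setC// B1 subee.
- by move=> x /= x0 xB; apply: x0; exact: xB 0%N.
Qed.

(** The averages tend to 0 almost everywhere, by the one-sided bound applied to [f] and [- f], each
    lowered by a small constant; they are bounded by [M], so dominated convergence concludes. *)
Theorem mean_ergodic f : bounded_mfun f -> \int[P]_x f x = 0 ->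
  (fun n => \int[P]_x `|n%:R^-1 * birkhoff n f x|) @ \oo --> (0 : R).
Proof.
move=> bf f0; have [_ [M fM]] := bf.
have bA n : bounded_mfun (fun x => n%:R^-1 * birkhoff n f x).
  exact/bounded_mfunZ/bounded_mfun_birkhoff.
have ub g k : bounded_mfun g -> \int[P]_x g x = 0 ->
    {ae P, forall x, exists K : nat, forall n,
      birkhoff n g x <= K%:R + n%:R * k.+1%:R^-1}.
  move=> bg g0; have := @birkhoff_ae_ubounded (fun x => g x - k.+1%:R^-1).
  rewrite RintegralB//; last 2 first.
  - exact: bounded_mfun_integrable.
  - exact/bounded_mfun_integrable/bounded_mfun_cst.
  rewrite g0 Rintegral_probability_cst sub0r oppr_lt0 invr_gt0 ltr0n.
  move=> /(_ _ isT)[]; first exact/bounded_mfunB/bounded_mfun_cst.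
  move=> N [mN N0 sN]; exists N; split => // x /= xK; apply: sN => /= -[K hK].
  apply: xK; exists K => n; have := hK n.
  by rewrite birkhoffB (birkhoff_cst n) lerBlDr.
rewrite -(Rintegral_probability_cst P 0).
apply: (@cvg_Rintegral_bounded _ _ _ P _ _ M).
- by move=> n; case: (bounded_mfun_norm (bA n)).
- move=> n x; rewrite normr_id normrM ger0_norm ?invr_ge0//.
  have [->|n0] := eqVneq n 0%N.
    by rewrite invr0 mul0r (le_trans _ (fM x)).
  rewrite ler_pdivrMl ?ltr0n ?lt0n// (le_trans (ler_norm_sum _ _ _))//.
  rewrite (le_trans (ler_sum _ (fun i _ => fM _)))//.
  by rewrite sumr_const card_ord mulr_natl.
- exact: bounded_mfun_cst.
have := ae_foralln (fun k => ub f k bf f0).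
have fN0 : \int[P]_x (- f x) = 0 by rewrite RintegralN// f0 oppr0.
have := ae_foralln (fun k => ub _ k (bounded_mfunN bf) fN0).
apply: filterS2 => x xN xf; apply/cvgr0Pnorm_le => e e0.
(* Half of [e] absorbs the slope [k.+1%:R^-1]; the other half absorbs the constants [K1] and [K2]
   once [n] is large. *)
pose k := Num.bound (2 * e^-1).
have ke : k.+1%:R^-1 <= e / 2.
  rewrite -[e / 2]invrK lef_pV2 ?posrE ?invr_gt0 ?divr_gt0//.
  rewrite invf_div; apply/ltW; apply: lt_trans (_ : k%:R < _); last by rewrite ltr_nat.
  by apply: archi_boundP; rewrite mulr_ge0// invr_ge0 ltW.
have [K1 hK1] := xN k; have [K2 hK2] := xf k.
exists (Num.bound (2 * (K1 + K2)%:R / e)).+1 => // n /= nK.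
have n0 : 0 < n%:R :> R by rewrite ltr0n (leq_trans _ nK).
have Kn : (K1 + K2)%:R <= n%:R * (e / 2).
  have : 2 * (K1 + K2)%:R / e < n%:R.
    apply: lt_le_trans (archi_boundP _) _; first by rewrite divr_ge0 ?mulr_ge0// ltW.
    by rewrite ler_nat ltnW.
  by rewrite ltr_pdivrMr// => /ltW; lra.
rewrite normr_id normrM ger0_norm ?invr_ge0// ler_pdivrMl// ler_norml.
have := hK1 n; rewrite birkhoffN; have := hK2 n.
have : n%:R * k.+1%:R^-1 <= n%:R * (e / 2) by rewrite ler_pM2l.
move: Kn; rewrite natrD; have := ler0n R K1; have := ler0n R K2.
move: (n%:R * k.+1%:R^-1) => z; set w := birkhoff _ _ _; move: w => w.
have -> : n%:R * (e / 2) = n%:R * e / 2 by rewrite mulrA.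
by move: (n%:R * e) => u *; apply/andP; split; lra.
Qed.

End mean_ergodic.

(** * Sequence spaces *)

Section sequence_space.
Context (L : pointedType).
Implicit Types y z : nat -> L.

Definition agree m y z := forall i, (i < m)%N -> y i = z i.

Lemma agree_sym m y z : agree m y z -> agree m z y.
Proof. by move=> yz i im; rewrite yz. Qed.

Lemma agree_trans m y z w : agree m y z -> agree m z w -> agree m y w.
Proof. by move=> yz zw i im; rewrite yz// zw. Qed.

(** Sequences agreeing with [y] on finitely many coordinates form a neighbourhood base of the
    product of discrete topologies. *)
Lemma nbhs_seqtopP (y : seqtop L) (U : set (seqtop L)) :
  nbhs y U <-> exists m, forall z : seqtop L, agree m y z -> U z.
Proof.
split=> [yU|[m yU]].
  (* Otherwise some [w m] outside [U] agrees with [y] on [m] letters for each [m]; the sequence [w]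
     converges to [y] coordinatewise, so it must enter [U]. *)
  apply: contrapT => /forallNP nU.
  have /choice[w hw] : forall m, exists z : seqtop L, agree m y z /\ ~ U z.
    by move=> m; have /existsNP[z /not_implyP] := nU m; exists z.
  have wy : w @ \oo --> y.
    apply/cvg_sup => N V [W] [[Q] oQ <-] QyN WV.
    apply: (filterS WV); rewrite nbhs_simpl; exists N.+1 => // i /= Ni.
    by rewrite -((hw i).1 N Ni).
  have [N _ /(_ N (leqnn N))] := wy _ yU.
  by move: (hw N) => [].
apply: (@filterS _ _ _ [set z : seqtop L | agree m y z]); first by move=> z /yU.
elim: m {yU} => [|m IH]; first exact: filterS filterT.
have : nbhs y [set z : seqtop L | y m = z m].
  have := @proj_continuous nat (fun=> discrete_topology L) m y.
  by apply; rewrite nbhs_principalE; apply/principal_filterP.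
apply: filterS2 IH => z yz ym i; rewrite ltnS leq_eqVlt => /predU1P[->//|].
exact: yz.
Qed.

Context (R : realType).
Implicit Types f g : Omega L -> R.

Definition depends_on m f := forall y z, agree m y z -> f y = f z.

Lemma Cb_depends_on m f M : depends_on m f -> (forall y, `|f y| <= M) -> Cb f.
Proof.
move=> fm fM; split; last by exists M.
move=> y V /nbhs_singleton Vy; apply/nbhs_seqtopP; exists m => z yz.
by rewrite /= -(fm _ _ yz).
Qed.

Lemma open_measurable_Omega (U : set (seqtop L)) :
  open U -> measurable (U : set (Omega L)).
Proof. by move=> oU; exact: sub_sigma_algebra. Qed.

Lemma Cb_bounded_mfun f : Cb f -> bounded_mfun f.
Proof.
move=> [cf [M fM]]; split; last by exists M.
apply: (measurability _ (RGenOInfty.measurableE R)) => //.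
move=> /= _ [_ [a ->] <-]; rewrite setTI; apply: open_measurable_Omega.
by move/continuousP : cf; apply; exact: interval_open.
Qed.

Lemma measurable_shift : measurable_fun setT (Defs.shift : Omega L -> Omega L).
Proof.
apply: (@measurability _ _ (Omega L) (Omega L) _ _ (@open (seqtop L)) erefl).
move=> /= _ [U oU <-]; rewrite setTI; apply: open_measurable_Omega.
rewrite openE => y /= Uy.
have /nbhs_seqtopP[m hm] : nbhs (Defs.shift y : seqtop L) U by exact: open_nbhs_nbhs.
by apply/nbhs_seqtopP; exists m.+1 => z yz; apply: hm => i im; exact: yz.
Qed.

(** For bounded [f], the largest minorant of [f] among functions of the first [m] coordinates. *)
Definition local_inf m f y := inf [set f z | z in agree m y].

Lemma depends_on_local_inf m f : depends_on m (local_inf m f).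
Proof.
move=> y z yz; congr inf; apply/seteqP; split => _ [w yw <-]; exists w => //.
  exact: agree_trans (agree_sym yz) yw.
exact: agree_trans yz yw.
Qed.

Lemma local_inf_le m f M y : (forall z, `|f z| <= M) -> local_inf m f y <= f y.
Proof.
move=> fM; apply: ge_inf; last by exists y.
by exists (- M) => _ [z _ <-]; have := fM z; rewrite ler_norml => /andP[].
Qed.

Lemma local_inf_ge m f y a : (forall z, agree m y z -> a <= f z) -> a <= local_inf m f y.
Proof.
move=> af; apply: lb_le_inf; first by exists (f y); exists y.
by move=> _ [z yz <-]; exact: af.
Qed.

Lemma local_inf_norm m f M : (forall y, `|f y| <= M) ->
  forall y, `|local_inf m f y| <= M.
Proof.
move=> fM y; rewrite ler_norml; apply/andP; split.
  by apply: local_inf_ge => z _; have := fM z; rewrite ler_norml => /andP[].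
apply: le_trans (local_inf_le _ _ fM) _; exact: le_trans (ler_norm _) (fM y).
Qed.

Lemma cvg_local_inf f y : Cb f -> (fun m => local_inf m f y) @ \oo --> f y.
Proof.
move=> [cf [M fM]]; apply/cvgrPdist_le => e e0.
have /nbhs_seqtopP[m hm] : nbhs (y : seqtop L) [set z | `|f y - f z| < e].
  by have /cvgrPdist_lt := cf y; apply.
exists m => // k /= mk; rewrite ger0_norm ?subr_ge0 ?(local_inf_le _ _ fM)//.
rewrite lerBlDr -lerBlDl; apply: local_inf_ge => z yz.
have /hm/= : agree m y z by move=> i im; apply: yz; exact: leq_trans im mk.
by rewrite ltr_norml => /andP[_]; lra.
Qed.

Lemma avg_le (y : nat -> L) n f g : (forall z, f z <= g z) -> avg y n f <= avg y n g.
Proof. by move=> fg; rewrite ler_wpM2l ?invr_ge0// ler_sum. Qed.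

Lemma avgN (y : nat -> L) n f : avg y n (fun z => - f z) = - avg y n f.
Proof. by rewrite /avg sumrN mulrN. Qed.

(* By continuity [local_inf m f] increases to [f], so convergence on functions
   of finitely many coordinates bounds the lower limit of the averages of [f];
   the upper limit is handled by [- f]. *)
Lemma cvg_avg_local (nu : probability (Omega L) R) (x : nat -> L) (ns : nat -> nat) :
  (forall m g, depends_on m g -> Cb g ->
     (fun k => avg x (ns k) g) @ \oo --> \int[nu]_y g y) ->
  forall f, Cb f -> (fun k => avg x (ns k) f) @ \oo --> \int[nu]_y f y.
Proof.
move=> cvg_loc.
have lower f e : Cb f -> 0 < e ->
    \forall k \near \oo, \int[nu]_y f y - e <= avg x (ns k) f.
  move=> bf e0; have [_ [M fM]] := bf.
  have bg m : Cb (local_inf m f).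
    exact: Cb_depends_on (@depends_on_local_inf m f) (local_inf_norm m fM).
  have : (fun m => \int[nu]_y local_inf m f y) @ \oo --> \int[nu]_y f y.
    apply: (@cvg_Rintegral_bounded _ _ _ _ _ _ M) => //.
    - by move=> m; case: (Cb_bounded_mfun (bg m)).
    - by move=> m y; exact: local_inf_norm.
    - exact: Cb_bounded_mfun.
    - by apply: aeW => y; exact: cvg_local_inf.
  (* Half of [e] pays for replacing [f] by [local_inf m f] in the integral, the other half for the
     convergence of the averages of [local_inf m f]. *)
  move=> /cvgrPdist_le/(_ _ (divr_gt0 e0 (ltr0n _ 2)))[m _ /(_ m (leqnn m))] /= fm.
  have /cvgrPdist_le/(_ _ (divr_gt0 e0 (ltr0n _ 2))) :=
    cvg_loc m _ (@depends_on_local_inf m f) (bg m).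
  apply: filterS => k /= hk.
  apply: le_trans (avg_le _ _ (fun y => local_inf_le m y fM)).
  by move: fm hk; rewrite !ler_norml => /andP[_ ?] /andP[_]; lra.
move=> f bf; apply/cvgrPdist_le => e e0.
have bNf : Cb (fun y => - f y).
  have [cf [M fM]] := bf; split; last by exists M => y; rewrite normrN.
  by move=> y; exact: (cvgN (cf y)).
have := lower _ _ bNf e0; rewrite (RintegralN _ (Cb_bounded_mfun bf)).
apply: filterS2 (lower _ _ bf e0) => k; rewrite avgN ler_norml => *.
by apply/andP; split; lra.
Qed.

Lemma cvg_avg_EFin (nu : probability (Omega L) R) (x : nat -> L) (ns : nat -> nat) f :
  Cb f -> ((fun k => (avg x (ns k) f)%:E) @ \oo --> (\int[nu]_y (f y)%:E)%E) <->
  ((fun k => avg x (ns k) f) @ \oo --> \int[nu]_y f y).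
Proof.
move=> /Cb_bounded_mfun bf; rewrite -EFin_Rintegral//; split.
  by move=> /fine_cvgP[_].
by move=> h; exact: cvg_comp h _.
Qed.

End sequence_space.

(** * Sums over selected positions *)

Section selection.
Context (R : realType).
Implicit Types (b : nat -> bool) (h : nat -> R) (M : R) (s : nat -> nat).

Definition changes b n : R := \sum_(i < n) (b i != b i.+1)%:R.

Lemma changes_ge0 b n : 0 <= changes b n.
Proof. by apply: sumr_ge0. Qed.

(** Summation by parts: two boundary terms remain, together with one term of size at most [M] for
    each site where [b] changes. *)
Lemma selected_sum_shift1 b h M n : (forall i, `|h i| <= M) ->
  `|\sum_(i < n) (b i)%:R * h i - \sum_(i < n) (b i)%:R * h i.+1|
    <= M * (changes b n + 2).
Proof.
move=> hM; have M0 : 0 <= M := le_trans (normr_ge0 _) (hM 0%N).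
have -> : \sum_(i < n) (b i)%:R * h i - \sum_(i < n) (b i)%:R * h i.+1 =
    (b 0%N)%:R * h 0%N - (b n)%:R * h n +
    \sum_(i < n) ((b i.+1)%:R - (b i)%:R) * h i.+1.
  elim: n => [|n IH]; first by rewrite !big_ord0 !subrr addr0.
  rewrite !big_ord_recr /=.
  transitivity ((b 0%N)%:R * h 0%N - (b n)%:R * h n +
    \sum_(i < n) ((b i.+1)%:R - (b i)%:R) * h i.+1
    + (b n)%:R * h n - (b n)%:R * h n.+1); last by ring.
  by rewrite -IH; ring.
have bh i : `|(b i)%:R * h i| <= M.
  by case: (b i); rewrite ?mul1r ?mul0r ?normr0.
rewrite mulrDr addrC (le_trans (ler_normD _ _))// lerD//.
  rewrite mulr_sumr (le_trans (ler_norm_sum _ _ _))// ler_sum// => i _.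
  rewrite normrM mulrC ler_pM//.
  by case: (b i); case: (b i.+1); rewrite ?subrr ?subr0 ?sub0r ?normrN ?normr0 ?normr1.
by rewrite (le_trans (ler_normB _ _))// mulr_natr mulr2n lerD.
Qed.

Lemma selected_sum_shift b h M n j : (forall i, `|h i| <= M) ->
  `|\sum_(i < n) (b i)%:R * h i - \sum_(i < n) (b i)%:R * h (i + j)%N|
    <= j%:R * (M * (changes b n + 2)).
Proof.
move=> hM; elim: j => [|j IH].
  under [X in _ - X]eq_bigr do rewrite addn0.
  by rewrite subrr normr0 mul0r.
rewrite -[X in `|X|](subrKA (\sum_(i < n) (b i)%:R * h (i + j)%N)).
rewrite (le_trans (ler_normD _ _))// -natr1 mulrDl mul1r lerD//.
under [X in _ - X]eq_bigr do rewrite addnS -addSn.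
exact: (@selected_sum_shift1 b (fun i => h (i + j)%N)).
Qed.

(* Most selected positions start a long selected block, so a sum over selected
   positions is close to the same sum of window averages. *)
Lemma selected_sum_window b h M n l : (0 < l)%N -> (forall i, `|h i| <= M) ->
  `|\sum_(i < n) (b i)%:R * h i| <=
    l%:R * (M * (changes b n + 2)) +
    \sum_(i < n) `|l%:R^-1 * \sum_(j < l) h (i + j)%N|.
Proof.
move=> l0 hM; have l0' : 0 < l%:R :> R by rewrite ltr0n.
have M0 : 0 <= M := le_trans (normr_ge0 _) (hM 0%N).
set A := \sum_(i < n) (b i)%:R * h i.
pose W := \sum_(i < n) (b i)%:R * (l%:R^-1 * \sum_(j < l) h (i + j)%N).
rewrite -[A](subrK W) (le_trans (ler_normD _ _))// lerD//; last first.
  rewrite (le_trans (ler_norm_sum _ _ _))// ler_sum// => i _.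
  by case: (b i); rewrite ?mul1r// mul0r normr0.
(* [W] is the mean over [j < l] of the sums shifted by [j], so [A - W] is a mean of differences that
   [selected_sum_shift] bounds. *)
have -> : A - W = l%:R^-1 *
    \sum_(j < l) (A - \sum_(i < n) (b i)%:R * h (i + j)%N).
  rewrite sumrB sumr_const card_ord -[A *+ l]mulr_natl mulrBr mulKf ?gt_eqF//.
  congr (_ - _); rewrite exchange_big mulr_sumr; apply: eq_bigr => i _.
  by rewrite -mulr_sumr; ring.
rewrite normrM ger0_norm ?invr_ge0 ?ler0n//. rewrite ler_pdivrMl//.
rewrite (le_trans (ler_norm_sum _ _ _))//.
have -> : l%:R * (l%:R * (M * (changes b n + 2))) =
    \sum_(j < l) l%:R * (M * (changes b n + 2)).
  by rewrite sumr_const card_ord -[RHS]mulr_natl.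
apply: ler_sum => j _; apply: le_trans (selected_sum_shift b n j hM) _.
rewrite ler_wpM2r ?ler_nat ?(ltnW (ltn_ord j))//.
by rewrite mulr_ge0// addr_ge0// changes_ge0.
Qed.

Section enumeration.
Variable s : nat -> nat.
Hypothesis s_incr : forall k, (s k < s k.+1)%N.

Lemma enum_lt i j : (i < j)%N -> (s i < s j)%N.
Proof.
elim: j => // j IH; rewrite ltnS leq_eqVlt => /predU1P[->//|/IH ij].
exact: ltn_trans ij (s_incr j).
Qed.

Lemma enum_le i j : (i <= j)%N -> (s i <= s j)%N.
Proof. by rewrite leq_eqVlt => /predU1P[->//|/enum_lt/ltnW]. Qed.

Lemma leq_enum k : (k <= s k)%N.
Proof. by elim: k => // k IH; exact: leq_ltn_trans IH (s_incr k). Qed.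

Let b i := `[< range s i >].

Lemma selected_enum k : b (s k).
Proof. by apply/asboolP; exists k. Qed.

Lemma selected_gap k i : (s k < i < s k.+1)%N -> b i = false.
Proof.
move=> /andP[ki ik]; apply/asboolP => -[j _ ji]; move: ki ik; rewrite -ji.
by have [/enum_le|/enum_le] := leqP j k; lia.
Qed.

Lemma selected_before i : (i < s 0)%N -> b i = false.
Proof.
move=> i0; apply/asboolP => -[[|j] _ ji]; move: i0; rewrite -ji ?ltnn//.
by rewrite ltnNge ltnW// enum_lt.
Qed.

(** From [s k] to [s k.+1] the only selected site gained is [s k] itself. *)
Lemma selected_sum_enum h k :
  \sum_(i < s k) (b i)%:R * h i = \sum_(j < k) h (s j).
Proof.
elim: k => [|k IH].
  by rewrite big_ord0 big1// => i _; rewrite selected_before// mul0r.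
rewrite big_ord_recr /= -IH -!(big_mkord xpredT (fun i => (b i)%:R * h i)).
rewrite (big_cat_nat (n := s k))//=; last exact: ltnW.
congr (_ + _); rewrite big_ltn// selected_enum mul1r big_nat_cond big1 ?addr0//.
by move=> i /andP[ik _]; rewrite (selected_gap ik) mul0r.
Qed.

(** A gap after [s j] makes [b] change at the site [s j], and distinct [j] give distinct sites. *)
Lemma sum_enum_gaps k :
  \sum_(j < k) (s j.+1 != (s j).+1)%:R <= changes b (s k).
Proof.
apply: (@le_trans _ _ (\sum_(j < k) (b (s j) != b (s j).+1)%:R)).
  apply: ler_sum => j _; case: eqVneq => [_|ne]; first exact: ler0n.
  rewrite selected_enum (@selected_gap j) ?lexx//.
  by have := s_incr j; lia.
rewrite -(selected_sum_enum (fun i => (b i != b i.+1)%:R)) ler_sum// => i _.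
by case: (b i); rewrite ?mul1r// mul0r.
Qed.

(** Each unit shift of the window of indices brings in at most one new gap. *)
Lemma sum_enum_gaps_shift k m :
  \sum_(j < k) (s (j + m).+1 != (s (j + m)%N).+1)%:R <= changes b (s k) + m%:R :> R.
Proof.
apply: le_trans (lerD (sum_enum_gaps k) (lexx m%:R)).
elim: m => [|m IH]; first by under eq_bigr do rewrite addn0; rewrite addr0.
rewrite -natr1 addrA; apply: le_trans (lerD IH (lexx 1)).
under eq_bigr do rewrite addnS -addSn.
pose e j : R := (s (j + m).+1 != (s (j + m)%N).+1)%:R.
rewrite -[leLHS]/(\sum_(j < k) e j.+1) -[X in _ <= X + 1]/(\sum_(j < k) e j).
apply: (@le_trans _ _ (\sum_(j < k.+1) e j)).
  by rewrite big_ord_recl lerDr /e.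
by rewrite big_ord_recr lerD2l /= /e; case: (_ != _).
Qed.

End enumeration.
End selection.

(** * Local functions along a subsequence *)

Section selected_local.
Context (R : realType) (L : pointedType) (s : nat -> nat).
Hypothesis s_incr : forall k, (s k < s k.+1)%N.
Let b i := `[< range s i >].

Lemma iter_shift (y : nat -> L) n i : iter n Defs.shift y i = y (i + n)%N.
Proof. by elim: n i => [|n IH] i; rewrite ?addn0//= /Defs.shift IH addSnnS. Qed.

(** If there is no gap after any of [s j], ..., [s (j + m - 1)], then [x \o s] from [j] and [x] from
    [s j] share their first [m] letters, and the two values of [g] coincide. Otherwise they differ
    by at most [2 * M]. *)
Lemma selected_local_dist (x : nat -> L) (g : Omega L -> R) m M k :
  depends_on m g -> (forall y, `|g y| <= M) ->
  `|\sum_(j < k) g (iter j Defs.shift (x \o s)) -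
    \sum_(i < s k) (b i)%:R * g (iter i Defs.shift x)| <=
  2 * M * (m%:R * (changes R b (s k) + m%:R)).
Proof.
move=> gm gM; have M0 : 0 <= M := le_trans (normr_ge0 _) (gM point).
rewrite (selected_sum_enum s_incr (fun i => g (iter i Defs.shift x))) -sumrB.
pose e j : R := (s j.+1 != (s j).+1)%:R.
have e0 j : 0 <= e j by [].
have pt j : `|g (iter j Defs.shift (x \o s)) - g (iter (s j) Defs.shift x)| <=
    2 * M * \sum_(i < m) e (j + i)%N.
  have [/existsP[i hi]|] := boolP [exists i : 'I_m, s (j + i).+1 != (s (j + i)%N).+1].
    rewrite (le_trans (ler_normB _ _))// (le_trans (lerD (gM _) (gM _)))//.
    rewrite -mulr2n -[leLHS]mulr_natl -[leLHS]mulr1 ler_wpM2l ?mulr_ge0//.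
    rewrite (bigD1 i)//= /e hi lerDl; exact: sumr_ge0.
  rewrite negb_exists => /forallP he.
  rewrite (gm _ (iter (s j) Defs.shift x)) ?subrr ?normr0.
    by rewrite !mulr_ge0// sumr_ge0.
  move=> i im; rewrite !iter_shift /=; congr x.
  elim: i im => [|i IH] im; first by rewrite !add0n.
  have := he (Ordinal (ltnW im)); rewrite negbK /= => /eqP.
  by rewrite addSn [(i + j)%N]addnC => ->; rewrite [(j + i)%N]addnC IH ?addSn// ltnW.
apply: le_trans (ler_norm_sum _ _ _) _.
apply: (le_trans (ler_sum _ (fun (j : 'I_k) _ => pt j))).
(* After exchanging the sums, each offset [i < m] contributes one shifted count of gaps. *)
rewrite -mulr_sumr ler_wpM2l ?mulr_ge0// exchange_big /=.
have -> : m%:R * (changes R b (s k) + m%:R) = \sum_(i < m) (changes R b (s k) + m%:R).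
  by rewrite sumr_const card_ord -[RHS]mulr_natl.
apply: ler_sum => i _; apply: le_trans (sum_enum_gaps_shift R s_incr k i) _.
by rewrite lerD2l ler_nat ltnW.
Qed.

End selected_local.

(** * Limit points of binary sequences *)

Section binary_cylinders.
Implicit Types (w : seq bool) (y z : nat -> bool).

(* Words are read backwards: the head of a word is its last letter. *)
Fixpoint rev_prefix n z : seq bool :=
  if n is n'.+1 then z n' :: rev_prefix n' z else [::].

Lemma size_rev_prefix n z : size (rev_prefix n z) = n.
Proof. by elim: n => //= n ->. Qed.

Lemma eq_rev_prefix n y z : rev_prefix n y = rev_prefix n z <-> agree n y z.
Proof.
elim: n => [|n [IH1 IH2]] /=; first by split.
split=> [[yz /IH1 h] i|h]; last by rewrite h// IH2// => i im; apply: h; exact: ltnW.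
by rewrite ltnS leq_eqVlt => /predU1P[->//|]; exact: h.
Qed.

Definition cylinder w : set (nat -> bool) := [set z | rev_prefix (size w) z = w].

Lemma cylinder_rev_prefix n z : cylinder (rev_prefix n z) z.
Proof. by rewrite /cylinder /= size_rev_prefix. Qed.

Lemma open_cylinder w : open (cylinder w : set (seqtop bool)).
Proof.
rewrite openE => y /= yw; apply/nbhs_seqtopP; exists (size w) => z yz.
by rewrite /cylinder /= -[RHS]yw; apply/eq_rev_prefix/agree_sym.
Qed.

Lemma measurable_cylinder w : measurable (cylinder w : set (Omega bool)).
Proof. by apply: open_measurable_Omega; exact: open_cylinder. Qed.

(** * Measures with prescribed cylinder masses *)

Section tree_measure.
Context (R : realType) (p : seq bool -> R).
Hypothesis p_ge0 : forall w, 0 <= p w.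
Hypothesis p_nil : p [::] = 1.
Hypothesis p_split : forall w, p w = p (false :: w) + p (true :: w).

(* [0, 1[ is cut into consecutive intervals [tree_lo w, tree_lo w + p w[ for the
   words w of a given length; [tree_code u] is the sequence whose prefixes index
   the intervals containing u. *)
Fixpoint tree_lo w : R :=
  if w is c :: w' then tree_lo w' + (if c then p (false :: w') else 0) else 0.

Fixpoint tree_word (u : R) n : seq bool :=
  if n is n'.+1 then
    (tree_lo (tree_word u n') + p (false :: tree_word u n') <= u) :: tree_word u n'
  else [::].

Definition tree_code (u : R) : Omega bool :=
  fun n => tree_lo (tree_word u n) + p (false :: tree_word u n) <= u.

Lemma rev_prefix_tree_code u n : rev_prefix n (tree_code u) = tree_word u n.
Proof. by elim: n => //= n ->. Qed.

Lemma tree_code_cylinder_cons c w :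
  tree_code @^-1` cylinder (c :: w) =
  tree_code @^-1` cylinder w `&`
  [set` if c then `[tree_lo w + p (false :: w), +oo[ else `]-oo, tree_lo w + p (false :: w)[].
Proof.
apply/seteqP; case: c; split => u; rewrite /cylinder /= !rev_prefix_tree_code in_itv/=.
- by rewrite /tree_code => -[+ e]; rewrite e => ->.
- by rewrite /tree_code => -[->]; rewrite andbT => ->.
- by rewrite /tree_code => -[+ e]; rewrite e ltNge => ->.
- by rewrite /tree_code => -[->]; rewrite ltNge => /negbTE ->.
Qed.

Lemma measurable_tree_code_cylinder w : measurable (tree_code @^-1` cylinder w).
Proof.
elim: w => [|c w IH].
  by rewrite (_ : _ @^-1` _ = setT)//; apply/seteqP; split.
rewrite tree_code_cylinder_cons; exact: measurableI.
Qed.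

(** An open set is the union of the cylinders it contains, and there are only countably many
    words. *)
Lemma measurable_tree_code : measurable_fun setT tree_code.
Proof.
apply: (@measurability _ _ R (Omega bool) _ _ (@open (seqtop bool)) erefl).
move=> /= _ [U oU <-]; rewrite setTI.
rewrite (_ : _ @^-1` _ =
    \bigcup_(w in [set w | cylinder w `<=` U]) tree_code @^-1` cylinder w).
  rewrite bigcup_mkcond; apply: countable_bigcupT_measurable => // w.
  by case: ifP => // _; exact: measurable_tree_code_cylinder.
apply/seteqP; split=> [u /= Uu|u [w /= wU uw]]; last exact: wU.
have /nbhs_seqtopP[m hm] : nbhs (tree_code u : seqtop bool) U by exact: open_nbhs_nbhs.
exists (rev_prefix m (tree_code u)); last exact: cylinder_rev_prefix.
move=> z; rewrite /cylinder /= size_rev_prefix => /eq_rev_prefix zu.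
exact/hm/agree_sym.
Qed.

Lemma tree_code_cylinder01 w :
  tree_code @^-1` cylinder w `&` `[0, 1[%classic = `[tree_lo w, tree_lo w + p w[%classic.
Proof.
elim: w => [|c w IH].
  by rewrite /= p_nil add0r (_ : _ @^-1` _ = setT) ?setTI//; apply/seteqP; split.
rewrite tree_code_cylinder_cons setIAC IH; apply/seteqP.
have := p_split w; have := p_ge0 (false :: w); have := p_ge0 (true :: w).
by case: c => /= *; split => u /=; rewrite !in_itv/= => *; lra.
Qed.

(** Kolmogorov extension for binary sequences: [nu] is the law of [tree_code] under the uniform
    distribution, and the preimage of a cylinder is, up to a null set, an interval of length
    [p w]. *)
Lemma tree_measure :
  exists nu : probability (Omega bool) R, forall w, nu (cylinder w) = (p w)%:E.
Proof.
have mf : @measurable_fun _ _ (measurableTypeR R) (Omega bool) setT tree_code.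
  exact: measurable_tree_code.
pose X := MeasurableFun.Pack (MeasurableFun.Class (isMeasurableFun.Build _ _ _ _ _ mf)).
exists (distribution (uniform_prob (@ltr01 R)) X) => w.
rewrite /distribution /pushforward /= /uniform_prob integral_uniform_pdf.
set U := _ @^-1` _.
have mU : measurable U by exact: measurable_tree_code_cylinder.
have mI : measurable (U `&` `[0, 1]%classic) by apply: measurableI => //; exact: measurable_itv.
rewrite (eq_integral (cst 1%E)); last first.
  move=> x; rewrite inE /= => -[_]; rewrite in_itv /uniform_pdf /= => ->.
  by rewrite subr0 invr1.
rewrite integral_cst// mul1e.
have leb_lo : lebesgue_measure `[tree_lo w, tree_lo w + p w[%classic = (p w)%:E.
  rewrite lebesgue_measure_itv/= lte_fin ltrDl; case: ltP => [_|pw].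
    by rewrite -EFinB addrAC subrr add0r.
  by have := p_ge0 w => ?; congr EFin; lra.
(* The uniform law lives on the closed interval while the coding intervals are half-open; the
   additional point 1 is null. *)
apply/eqP; rewrite eq_le -leb_lo -tree_code_cylinder01; apply/andP; split.
  apply: (@le_trans _ _ (lebesgue_measure ((U `&` `[0, 1[%classic) `|` [set 1 : R]))).
    apply: le_measure; rewrite ?inE//.
      by apply: measurableU => //; apply: measurableI => //; exact: measurable_itv.
    move=> u /= [Uu]; rewrite !in_itv/= => /andP[u0].
    by rewrite le_eqVlt => /predU1P[->|u1]; [right|left; split; rewrite ?u0].
  apply: le_trans (measureU2 _ _ _) _ => //.
    by apply: measurableI => //; exact: measurable_itv.
  rewrite -[leRHS]adde0; apply: leeD2l => //.
  by have /eqP := lebesgue_measure_set1 (1 : R); rewrite eq_le => /andP[].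
apply: le_measure; rewrite ?inE//.
  by apply: measurableI => //; exact: measurable_itv.
by move=> u /= [Uu]; rewrite !in_itv/= => /andP[-> /ltW ->].
Qed.

End tree_measure.
End binary_cylinders.

(** * Existence of limit points along an infinite set of times *)

Section limit_points.
Context (R : realType) (Y : Omega bool).
Implicit Types (w : seq bool) (f g : Omega bool -> R).

Let cyl w : set (Omega bool) := cylinder w.
Let freq w n : R := avg Y n (\1_(cyl w)).

Lemma avgD n f g : avg Y n (fun y => f y + g y) = avg Y n f + avg Y n g.
Proof. by rewrite /avg big_split mulrDr. Qed.

Lemma avgZ n (c : R) f : avg Y n (fun y => c * f y) = c * avg Y n f.
Proof. by rewrite /avg -mulr_sumr mulrCA. Qed.

Lemma freq_itv w n : 0 <= freq w n <= 1.
Proof.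
apply/andP; split; first by rewrite mulr_ge0 ?invr_ge0// sumr_ge0.
have [->|n0] := eqVneq n 0%N; first by rewrite /freq /avg invr0 mul0r.
rewrite /freq /avg ler_pdivrMl ?ltr0n ?lt0n// mulr1.
apply: (@le_trans _ _ (\sum_(i < n) 1)); last by rewrite sumr_const card_ord.
by apply: ler_sum => i _; rewrite indicE lern1 leq_b1.
Qed.

Lemma freq_nil n : (0 < n)%N -> freq [::] n = 1.
Proof.
move=> n0; rewrite /freq /avg (eq_bigr (fun=> 1)).
  by rewrite sumr_const card_ord mulVf// pnatr_eq0 -lt0n.
by move=> i _; rewrite indicE mem_set.
Qed.

Lemma freq_split w n : freq w n = freq (false :: w) n + freq (true :: w) n.
Proof.
rewrite /freq -avgD; congr avg; apply/funext => y; rewrite !indicE.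
have [wy|nwy] := pselect (cyl w y); last first.
  by rewrite !memNset ?addr0// /cyl /cylinder /= => -[_] /nwy.
rewrite mem_set//; case e : (y (size w)); rewrite /cyl.
  rewrite memNset ?mem_set ?add0r//= /cylinder/=; first by rewrite e wy.
  by rewrite e.
rewrite mem_set ?memNset ?addr0//= /cylinder/=; last by rewrite e wy.
by rewrite e.
Qed.

Variable Q : nat -> Prop.
Hypothesis Q_inf : forall N, exists n, (N <= n)%N /\ Q n.

(** An ultrafilter containing [Q] and all tails gives every cylinder frequency a limit at once, by
    compactness of the unit interval. Additivity passes to these limits, and a diagonal choice
    extracts a sequence of times. *)
Lemma cylinder_limits : exists (ns : nat -> nat) (p : seq bool -> R),
  [/\ forall k, (ns k < ns k.+1)%N, forall k, Q (ns k),
      forall w, (fun k => freq w (ns k)) @ \oo --> p w &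
      [/\ forall w, 0 <= p w, p [::] = 1 &
          forall w, p w = p (false :: w) + p (true :: w)]].
Proof.
have QF : ProperFilter (within Q \oo).
  split; last exact: within_filter.
  move=> [N _ NQ]; have [n [Nn Qn]] := Q_inf N; exact: NQ Qn.
have [G [UG QG]] := ultraFilterLemma QF.
have PG : ProperFilter G := ultra_proper.
have GN N : G [set n | (N < n)%N].
  by apply: QG; exists N.+1 => // n.
have GQ : G Q by apply: QG; exact: withinT.
have /choice[p hp] : forall w, exists a : R, 0 <= a /\ freq w @ G --> a.
  move=> w; have FF : ProperFilter (freq w @ G) by exact: fmap_proper_filter.
  have : (freq w @ G) `[0, 1]%classic.
    by apply: (@filterE nat G) => n; rewrite /= in_itv; exact: freq_itv.
  move=> /(@segment_compact R 0 1 _ FF)[a []] /=.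
  rewrite in_itv/= => /andP[a0 _] aG; exists a; split => // V aV.
  have [//|nV] := in_ultra_setVsetC (freq w @^-1` V) UG.
  by have [b []] := aG (~` V) V nV aV.
have p_cvg w : freq w @ G --> p w by case: (hp w).
have near_p j e : 0 < e -> G [set n | forall w, (pickle w < j)%N -> `|p w - freq w n| <= e].
  move=> e0; elim: j => [|j IH]; first exact: filterE.
  have [[w0 ej]|nj] := pselect (exists w0 : seq bool, pickle w0 = j); last first.
    apply: filterS IH => n hn w; rewrite ltnS leq_eqVlt => /orP[/eqP wj|]; last exact: hn.
    by case: nj; exists w.
  have /cvgrPdist_le/(_ _ e0) := p_cvg w0.
  apply: filterS2 IH => n hn hw0 w; rewrite ltnS leq_eqVlt => /orP[/eqP wj|]; last exact: hn.
  suff -> : w = w0 by [].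
  by apply: (pcan_inj pickleK); rewrite wj ej.
have /choice[next hnext] : forall kN : nat * nat, exists n, [/\ (kN.2 < n)%N, Q n &
    forall w, (pickle w < kN.1)%N -> `|p w - freq w n| <= kN.1.+1%:R^-1].
  move=> [k N] /=; have k0 : 0 < k.+1%:R^-1 :> R by rewrite invr_gt0.
  have [n [[] ? ? ?]] := filter_ex (filterI (filterI (GN N) GQ) (near_p k _ k0)).
  by exists n.
(* The time [ns k] lies beyond the previous one and is accurate up to [k.+1%:R^-1] on the words of
   code below [k]. *)
pose fix ns k := next (k, if k is k'.+1 then ns k' else 0%N).
exists ns, p; split.
- by move=> k; have [] := hnext (k.+1, ns k).
- by move=> [|k]; [have [] := hnext (0, 0)%N|have [] := hnext (k.+1, ns k)].
- move=> w; apply/cvgrPdist_le => e e0.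
  exists (maxn (pickle w).+1 (Num.bound e^-1)) => // k /=; rewrite geq_max => /andP[wk ek].
  have : `|p w - freq w (ns k)| <= k.+1%:R^-1.
    by case: k wk {ek} => // k wk; have [_ _] := hnext (k.+1, ns k); apply.
  move=> /le_trans; apply; rewrite -[e]invrK lef_pV2 ?posrE ?invr_gt0//.
  apply/ltW/(lt_le_trans (archi_boundP _)); first by rewrite invr_ge0 ltW.
  by rewrite ler_nat ltnW.
- split=> [w||w]; first by case: (hp w).
    apply: (cvg_unique _ (p_cvg [::])) => //; apply: cvg_near_cst.
    by apply: filterS (GN 0%N) => n n0; rewrite freq_nil.
  apply: (cvg_unique _ (p_cvg w)) => //.
  rewrite (_ : freq w = fun n => freq (false :: w) n + freq (true :: w) n).
    by apply: cvgD; exact: p_cvg.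
  by apply/funext => n; exact: freq_split.
Qed.

(** A sample point of the cylinder of [w], where a local function can be evaluated. *)
Fixpoint word_extension w : nat -> bool :=
  if w is c :: w' then fun i => if i == size w' then c else word_extension w' i
  else fun=> false.

Lemma rev_prefix_word_extension w : rev_prefix (size w) (word_extension w) = w.
Proof.
elim: w => //= c w IH; rewrite eqxx; congr (_ :: _).
rewrite -[RHS]IH; apply/eq_rev_prefix => i iw /=.
by rewrite ltn_eqF.
Qed.

(** [g] is constant on each cylinder of length [m], and exactly one of them contains [y]. *)
Lemma depends_on_sum_cylinder m g : depends_on m g ->
  g = fun y => \sum_(w : m.-tuple bool) g (word_extension w) * \1_(cyl w) y.
Proof.
move=> gm; apply/funext => y.
pose w0 := @Tuple m _ (rev_prefix m y) (introT eqP (size_rev_prefix m y)).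
rewrite (bigD1 w0)//= big1 ?addr0 => [|w ww0].
  rewrite indicE mem_set ?mulr1; last exact: cylinder_rev_prefix.
  apply: gm; apply/eq_rev_prefix.
  by rewrite -[LHS](rev_prefix_word_extension (rev_prefix m y)) size_rev_prefix.
rewrite indicE memNset ?mulr0// /cyl /cylinder /= size_tuple => e.
by move/eqP: ww0; apply; apply: val_inj; rewrite /= e.
Qed.

(** [tree_measure] realises the limiting frequencies. Convergence extends from cylinders to local
    functions by linearity, then to [Cb] by [cvg_avg_local]. *)
Lemma accum_point_ex : exists (nu : probability (Omega bool) R) (ns : nat -> nat),
  [/\ forall k, (ns k < ns k.+1)%N, forall k, Q (ns k) &
    forall f, Cb f -> (fun k => avg Y (ns k) f) @ \oo --> \int[nu]_y f y].
Proof.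
have [ns [p [ns_incr nsQ p_cvg [p0 p1 p_split]]]] := cylinder_limits.
have [nu nuE] := tree_measure p0 p1 p_split.
exists nu, ns; split => //; apply: cvg_avg_local => m g gm _.
rewrite (depends_on_sum_cylinder gm).
have bcyl w : bounded_mfun (\1_(cyl w) : Omega bool -> R).
  by apply: bounded_mfun_indic; exact: measurable_cylinder.
elim: (index_enum _) => [|w r IH].
  under eq_fun do (rewrite /avg; under eq_bigr do rewrite big_nil).
  rewrite (_ : \int[nu]_y _ = 0).
    by apply: cvg_near_cst; apply: nearW => n; rewrite sumr_const mul0rn mulr0.
  by under eq_Rintegral do rewrite big_nil; rewrite Rintegral_probability_cst.
have bw : bounded_mfun (fun y : Omega bool => g (word_extension w) * \1_(cyl w) y).
  exact/bounded_mfunZ.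
have br : bounded_mfun (fun y : Omega bool =>
    \sum_(w <- r) g (word_extension w) * \1_(cyl (w : m.-tuple bool)) y).
  by apply: bounded_mfun_sum => v; exact/bounded_mfunZ.
rewrite (_ : (fun y : Omega bool => _) = fun y => g (word_extension w) * \1_(cyl w) y +
  \sum_(w <- r) g (word_extension w) * \1_(cyl w) y); last first.
  by apply/funext => y; rewrite big_cons.
under eq_fun do rewrite avgD avgZ.
rewrite RintegralD//; try exact: bounded_mfun_integrable.
apply: cvgD => //; rewrite RintegralZl//; last exact: bounded_mfun_integrable.
apply: cvgMl_tmp; rewrite (_ : \int[nu]_y _ = p w); first exact: p_cvg.
rewrite /Rintegral integral_indic ?setIT//; last exact: measurable_cylinder.
rewrite -[RHS]/(fine (p w)%:E); congr fine; exact: nuE.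
Qed.

End limit_points.

(** * Superficial sets *)

Section superficial_sets.
Context (R : realType) (S : set nat).
Let b i := `[< S i >].

(** If this failed, infinitely many times would have a proportion of changes at least some [e > 0].
    A limit point along such times is a mixture of point masses at constant sequences, so it gives
    [D] no mass, although the indicator of [D] is continuous: a contradiction. *)
Lemma superficial_changes : superficial R S ->
  (fun n => n%:R^-1 * changes R b n) @ \oo --> (0 : R).
Proof.
move=> S_sup; pose D := [set y : Omega bool | y 0%N != y 1%N].
have D2 : depends_on 2 (\1_D : Omega bool -> R).
  by move=> y z yz; rewrite !indicE; congr (_%:R); congr nat_of_bool;
    apply/idP/idP; rewrite !inE /D /= !yz.
have bD y : `|\1_D y| <= (1 : R) by rewrite indicE ger0_norm// lern1 leq_b1.
have avgD n : avg (Defs.indic S) n \1_D = n%:R^-1 * changes R b n.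
  congr (_ * _); apply: eq_bigr => i _; rewrite indicE; congr (_%:R).
  congr nat_of_bool; by apply/idP/idP; rewrite inE /D /= !iter_shift add0n add1n.
apply/cvgrPdist_lt => e e0; apply: contrapT => not_near.
have Q_inf N : exists n, (N <= n)%N /\ ~ (`|0 - n%:R^-1 * changes R b n| < e).
  apply: contrapT => nex; apply: not_near; exists N => // n /= Nn.
  by apply: contrapT => nlt; apply: nex; exists n.
have [nu [ns [ns_incr nsQ ns_cvg]]] := accum_point_ex R (Defs.indic S) Q_inf.
have [|t [_ nuE]] := S_sup nu.
  by exists ns; split => // f Cf; apply/cvg_avg_EFin => //; exact: ns_cvg.
have mD : measurable D.
  have [mf _] := Cb_bounded_mfun (Cb_depends_on D2 bD).
  have := mf measurableT [set 1]; rewrite setTI.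
  rewrite (_ : _ @^-1` _ = D); first by apply.
  apply/seteqP; split => y /=; rewrite indicE.
    by have [//|nDy] := pselect (D y); rewrite memNset// => /eqP; rewrite eq_sym oner_eq0.
  by move=> Dy; rewrite mem_set.
have nuD : \int[nu]_y \1_D y = 0.
  rewrite /Rintegral integral_indic// setIT -[RHS]/(fine (0%:E : \bar R)).
  congr fine; apply: (etrans (nuE _ mD)); rewrite !diracE !memNset /D /= ?eqxx//.
  by rewrite !mule0 adde0.
have := ns_cvg _ (Cb_depends_on D2 bD); rewrite nuD => /cvgrPdist_lt/(_ _ e0).
by move=> [N _ /(_ N (leqnn N))]; rewrite /= avgD; exact: nsQ.
Qed.

(** The lower limit is the supremum of the tail infima, so one of them is positive and serves as
    [c]. *)
Lemma lower_density_gt0 : 0 < lower_density R S ->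
  exists2 c : R, 0 < c & exists N, forall n, (N <= n)%N ->
    c <= n%:R^-1 * \sum_(i < n) (\1_S i : R).
Proof.
rewrite /lower_density; set u := (fun n : nat => _).
have u_itv n : 0 <= u n <= 1.
  rewrite /u; apply/andP; split; first by rewrite mulr_ge0 ?invr_ge0// sumr_ge0.
  have [->|n0] := eqVneq n 0%N; first by rewrite invr0 mul0r.
  rewrite ler_pdivrMl ?ltr0n ?lt0n// mulr1.
  apply: (@le_trans _ _ (\sum_(i < n) 1)); last by rewrite sumr_const card_ord.
  by apply: ler_sum => i _; rewrite indicE lern1 leq_b1.
have bu : bounded_fun u.
  exists 1; split; first exact: num_real.
  move=> M M1 n _ /=; have /andP[u0 u1] := u_itv n.
  by rewrite ger0_norm// (le_trans u1)// ltW.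
rewrite limn_infE// => /sup_gt[]; first by exists (infs u 0%N), 0%N.
move=> _ [N _ <-] c0; exists (infs u N) => //; exists N => n Nn.
apply: ge_inf; last by exists n.
by exists 0 => _ [k _ <-]; case/andP : (u_itv k).
Qed.

End superficial_sets.

(** * Preservation of normality *)

Lemma cvg_inv_natr (R : realType) : (fun n => n%:R^-1 : R) @ \oo --> (0 : R).
Proof. by rewrite -cvg_shiftS; exact: cvg_harmonic. Qed.

Lemma cvg_avg_selected_centered (R : realType) (L : pointedType)
  (mu : probability (Omega L) R) (s : nat -> nat) m (g : Omega L -> R) (x : Omega L) :
  shift_invariant mu -> ergodic mu -> (forall k, (s k < s k.+1)%N) ->
  superficial R (range s) -> 0 < lower_density R (range s) -> normal mu x ->
  depends_on m g -> Cb g -> \int[mu]_y g y = 0 ->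
  (fun k => avg (x \o s) k g) @ \oo --> (0 : R).
Proof.
move=> mu_inv mu_erg s_incr S_sup S_dens nx gm Cg g0.
have bg := Cb_bounded_mfun Cg; have [_ [M gM]] := bg.
have M0 : 0 <= M := le_trans (normr_ge0 _) (gM point).
have [c c0 [N Nc]] := lower_density_gt0 S_dens.
pose b i := `[< range s i >].
(* Exactly [k] elements of the range lie below [s k], so the density bound at [n = s k] compares the
   two normalisations. *)
have s_dens k : (N <= k)%N -> c * (s k)%:R <= k%:R.
  move=> Nk; have := Nc _ (leq_trans Nk (leq_enum s_incr k)).
  have [->|sk0] := eqVneq (s k) 0%N; first by rewrite mulr0.
  rewrite ler_pdivlMl ?ltr0n ?lt0n// mulrC => /le_trans; apply.
  have := selected_sum_enum s_incr (fun=> 1 : R) k.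
  rewrite sumr_const card_ord => <-; apply: ler_sum => i _.
  rewrite mulr1 indicE ler_nat; have [h|h] := pselect (range s i).
    by rewrite asboolT// leq_b1.
  by rewrite memNset.
pose H l (y : Omega L) := `|l%:R^-1 * birkhoff (Defs.shift : Omega L -> Omega L) l g y|.
have CH l : Cb (H l).
  have [_ [K HK]] := bounded_mfun_norm (bounded_mfunZ l%:R^-1
    (bounded_mfun_birkhoff (@measurable_shift L) l bg)).
  apply: (@Cb_depends_on _ _ (l + m) _ K) HK => y z yz.
  rewrite /birkhoff; congr (`|_ * _|); apply: eq_bigr => i _; apply: gm => j jm.
  by rewrite !iter_shift; apply: yz; have := ltn_ord i; lia.
apply/cvgr0Pnorm_le => e e0; have ce0 : 0 < c * e by rewrite mulr_gt0.
(* The factor [c] anticipates the change of normalisation from [s k] to [k]. *)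
have [l l0 Hl] : exists2 l, (0 < l)%N & \int[mu]_y H l y < c * e.
  have /cvgr0Pnorm_lt/(_ _ ce0)[l _ /(_ l.+1 (leqnSn _)) hl] :=
    mean_ergodic (@measurable_shift L) mu_inv mu_erg bg g0.
  by exists l.+1 => //; exact: le_lt_trans (ler_norm _) hl.
(* At [n = s k] this is the sum of the bounds of [selected_local_dist] and [selected_sum_window],
   divided by [n]. The first two terms vanish in the limit, by sparsity of changes and because [l]
   and [m] are fixed. *)
pose E n := (2 * M * m%:R + l%:R * M) * (n%:R^-1 * changes R b n) +
  (2 * M * m%:R * m%:R + l%:R * M * 2) * n%:R^-1 + avg x n (H l).
have E_cvg : E @ \oo --> \int[mu]_y H l y.
  rewrite -[X in _ --> X]add0r; apply: cvgD; last first.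
    exact: (cvg_avg_EFin mu x id (CH l)).1 (nx _ (CH l)).
  rewrite -[X in _ --> X](addr0 0); apply: cvgD.
    by rewrite -[X in _ --> X](mulr0 (2 * M * m%:R + l%:R * M)); apply: cvgMl_tmp;
      exact: superficial_changes.
  by rewrite -[X in _ --> X](mulr0 (2 * M * m%:R * m%:R + l%:R * M * 2)); apply: cvgMl_tmp;
    exact: cvg_inv_natr.
have [N' _ hN'] : \forall n \near \oo, E n <= c * e.
  have /cvgrPdist_lt := E_cvg; move=> /(_ (c * e - \int[mu]_y H l y)).
  rewrite subr_gt0 => /(_ Hl); apply: filterS => n.
  by rewrite ltr_norml => /andP[+ _]; lra.
exists (maxn (maxn N N') 1) => // k /=; rewrite !geq_max -andbA => /and3P[Nk N'k k0].
have sk0 : (0 < s k)%N := leq_trans k0 (leq_enum s_incr k).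
have := hN' _ (leq_trans N'k (leq_enum s_incr k)).
have -> : E (s k) = (s k)%:R^-1 * (2 * M * (m%:R * (changes R b (s k) + m%:R)) +
    (l%:R * (M * (changes R b (s k) + 2)) +
     \sum_(i < s k) H l (iter i Defs.shift x))).
  by rewrite /E /avg; ring.
rewrite ler_pdivrMl ?ltr0n// => hE.
rewrite /avg normrM ger0_norm ?invr_ge0// ler_pdivrMl ?ltr0n//.
apply: (@le_trans _ _ ((s k)%:R * (c * e))); last first.
  by rewrite mulrA ler_wpM2r ?(ltW e0)// mulrC s_dens.
apply: le_trans hE.
rewrite -[X in `|X|](subrK (\sum_(i < s k) (b i)%:R * g (iter i Defs.shift x))).
apply: le_trans (ler_normD _ _) _; apply: lerD; first exact: selected_local_dist.
apply: le_trans (selected_sum_window b (s k) l0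
  (fun i => gM (iter i Defs.shift x))) _.
rewrite lerD2l; apply: ler_sum => i _; rewrite /H /birkhoff.
by under eq_bigr do rewrite addnC iterD.
Qed.

(* S is given through its increasing enumeration s, so that x|_S = x \o s. *)
Theorem mainTheorem4 (R : realType) (L : pointedType)
  (hL : countable [set: L])
  (mu : probability (Omega L) R)
  (mu_inv : shift_invariant mu) (mu_erg : ergodic mu)
  (s : nat -> nat) (s_incr : forall k, (s k < s k.+1)%N)
  (S_sup : superficial R (range s))
  (S_dens : 0 < lower_density R (range s)) :
  forall x : Omega L, normal mu x -> normal mu (x \o s : Omega L).
Proof.
move=> x nx f Cf; apply/(cvg_avg_EFin mu (x \o s) id Cf).
apply: (cvg_avg_local _ Cf) => m g gm Cg.
(* Subtracting the mean [I] keeps [g] local and reduces to the centred case. *)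
pose I := \int[mu]_y g y; have bg := Cb_bounded_mfun Cg.
have [_ [M gM]] := Cg.
have hm : depends_on m (fun y => g y - I) by move=> y z /gm ->.
have hM y : `|g y - I| <= M + `|I|.
  by apply: le_trans (ler_normB _ _) _; rewrite lerD2r.
have Ch := Cb_depends_on hm hM.
have h0 : \int[mu]_y (g y - I) = 0.
  rewrite RintegralB//; try exact: bounded_mfun_integrable.
    by rewrite Rintegral_probability_cst subrr.
  exact/bounded_mfun_integrable/bounded_mfun_cst.
have := cvg_avg_selected_centered mu_inv mu_erg s_incr S_sup S_dens nx hm Ch h0.
move=> /cvgr0Pnorm_le h; apply/cvgrPdist_le => e /h [N _ hN].
(* The average of the constant [I] equals [I] only for [k > 0], hence the successor. *)
exists N.+1 => // k /= Nk; have := hN k (ltnW Nk).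
rewrite /avg sumrB sumr_const card_ord -[I *+ k]mulr_natl mulrBr mulKf ?pnatr_eq0 -?lt0n.
  by rewrite distrC.
exact: leq_trans Nk.
Qed.
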